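(* For all integers $p$ and $n$, \[ Q_{ - n} P_{p} - P_{p-n} = Q_nP_{p + n} -P_{p + 2n} \] and \[ P_pP_{-n-3}-P_{p+1}P_{-n-4}=P_{p+n+1}P_{n-4}-P_{p+n}P_{n-3}. \]
   Context: The Padovan numbers $P_n$ are defined for all integers $n$ by $P_0=P_1=P_2=1$ and $P_n=P_{n-2}+P_{n-3}$ for all integers $n$ (extended to negative indices via $P_n=P_{n+3}-P_{n+1}$). The Perrin numbers $Q_n$ are defined for all integers $n$ by $Q_0=3$, $Q_1=0$, $Q_2=2$ and $Q_n=Q_{n-2}+Q_{n-3}$ for all integers $n$. *)

(* Defs.v *)
From mathcomp Require Import all_boot all_order all_algebra.

Set Implicit Arguments.
Unset Strict Implicit.
Unset Printing Implicit Defensive.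

Import GRing.Theory.
Local Open Scope ring_scope.

(* A solution u of u n = u (n - 2) + u (n - 3) is computed through the window
   (u n, u (n + 1), u (n + 2)), moved forwards or backwards one index at a
   time; the backward step is u (n - 1) = u (n + 2) - u n. *)
Definition next_window (w : int * int * int) : int * int * int :=
  let: (a, b, c) := w in (b, c, a + b).

Definition prev_window (w : int * int * int) : int * int * int :=
  let: (a, b, c) := w in (c - a, a, b).

Definition window (w : int * int * int) (n : int) : int * int * int :=
  match n with
  | Posz k => iter k next_window w
  | Negz k => iter k.+1 prev_window w
  end.

Definition padovan (n : int) : int := (window (1, 1, 1) n).1.1.

Definition perrin (n : int) : int := (window (3, 0, 2) n).1.1.

Lemma prev_windowK : cancel prev_window next_window.
Proof. by case=> [[a b] c]; rewrite /= subrK. Qed.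

Lemma windowS w n : window w (n + 1) = next_window (window w n).
Proof.
case: n => k; first by rewrite -PoszD addn1.
have -> : Negz k + 1 = - k%:Z by rewrite NegzE -addn1 PoszD opprD subrK.
by case: k => [|k]; rewrite ?oppr0 -?NegzE [window w (Negz _)]/= prev_windowK.
Qed.

Lemma window_rec w n :
  (window w n).1.1 = (window w (n - 2)).1.1 + (window w (n - 3)).1.1.
Proof.
have -> : window w n = next_window (next_window (next_window (window w (n - 3)))).
  by rewrite -!windowS -!addrA addr0.
have -> : window w (n - 2) = next_window (window w (n - 3)).
  by rewrite -windowS -addrA.
by case: (window w (n - 3)) => [[a b] c]; rewrite /= addrC.
Qed.

Lemma padovan_init : [/\ padovan 0 = 1, padovan 1 = 1 & padovan 2 = 1].
Proof. by []. Qed.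

Lemma padovan_rec n : padovan n = padovan (n - 2) + padovan (n - 3).
Proof. exact: window_rec. Qed.

Lemma perrin_init : [/\ perrin 0 = 3, perrin 1 = 0 & perrin 2 = 2].
Proof. by []. Qed.

Lemma perrin_rec n : perrin n = perrin (n - 2) + perrin (n - 3).
Proof. exact: window_rec. Qed.

(* Main.v *)
(* Let X be the shift of index: on solutions of the recurrence X^3 = X + 1. If
   (a, b, c) is the window at n of the solution starting with 1, 0, 0, then
   X^n = a + c X + b X^2, so the window at m + n of any solution is obtained by
   letting a + c X + b X^2 act on the window at m. Since X has norm 1, the
   window at - n is read off the adjugate of multiplication by X^n, whose
   entries are quadratic in a, b, c. Every term of both identities is then
   quadratic in (a, b, c) and linear in the window of the Padovan sequence at
   p, and the identities hold formally. *)
Require Import Defs.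
From mathcomp Require Import all_boot all_order all_algebra.
From mathcomp Require Import ring.

Import GRing.Theory.
Local Open Scope ring_scope.

(** Injectivity of [g] gives the descent to negative indices: equal values at [- n] have equal
    preimages under [g]. *)
Lemma int_orbit_ext (T : Type) (g : T -> T) (f h : int -> T) :
  injective g -> (forall n, f (n + 1) = g (f n)) ->
  (forall n, h (n + 1) = g (h n)) -> f 0 = h 0 -> f =1 h.
Proof.
move=> g_inj fS hS fh0; elim/int_ind => [|n IHn|n IHn] //.
  by rewrite intS addrC fS hS IHn.
by apply: g_inj; rewrite -fS -hS intS opprD addrC addrA subrr add0r.
Qed.

Lemma next_windowK : cancel next_window prev_window.
Proof. by case=> [[a b] c]; rewrite /= addrK. Qed.

(* The action of a + c X + b X^2; the order of the coefficients is that of the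
   window (a, b, c), in which b is the coefficient of X^2. *)
Definition window_act (v w : int * int * int) : int * int * int :=
  let: (a, b, c) := v in let: (x, y, z) := w in
  (a * x + c * y + b * z,
   a * y + c * z + b * (x + y),
   a * z + c * (x + y) + b * (y + z)).

(* The first column of the adjugate of multiplication by a + c X + b X^2 in the
   basis 1, X, X^2, in the same order as above. *)
Definition window_adj (v : int * int * int) : int * int * int :=
  let: (a, b, c) := v in
  ((a + b) ^+ 2 - c * (b + c), c ^+ 2 - b * (a + b), b * (b + c) - c * (a + b)).

(** For fixed [m], both sides advance by [next_window] as [n] grows by 1. *)
Lemma windowD w m n :
  window w (m + n) = window_act (window (1, 0, 0) n) (window w m).
Proof.
move: n; apply: (int_orbit_ext _ next_window) => [|n|n|].
- exact: can_inj next_windowK.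
- by rewrite addrA windowS.
- rewrite windowS; case: (window _ n) => [[a b] c].
  by case: (window w m) => [[x y] z]; congr (_, _, _); ring.
- rewrite addr0; case: (window w m) => [[x y] z].
  by congr (_, _, _); ring.
Qed.

(** Both sides step by [prev_window] as [n] grows by 1. *)
Lemma windowN n :
  window (1, 0, 0) (- n) = window_adj (window (1, 0, 0) n).
Proof.
move: n; apply: (int_orbit_ext _ prev_window) => [|n|n|//].
- exact: can_inj prev_windowK.
- by rewrite -[in RHS](subrK 1 (- n)) windowS next_windowK opprD.
- rewrite windowS; case: (window _ n) => [[a b] c].
  by congr (_, _, _); ring.
Qed.

Theorem theorem6 (p n : int) :
  perrin (- n) * padovan p - padovan (p - n)
    = perrin n * padovan (p + n) - padovan (p + 2 * n)
  /\
  padovan p * padovan (- n - 3) - padovan (p + 1) * padovan (- n - 4)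
    = padovan (p + n + 1) * padovan (n - 4) - padovan (p + n) * padovan (n - 3).
Proof.
have perrinE m : perrin m = (window_act (window (1, 0, 0) m) (3, 0, 2)).1.1.
  by rewrite /perrin -{1}[m]add0r windowD.
(* The Padovan windows at -3 and -4 are [(0, 1, 0)] and [(0, 0, 1)]. *)
have padovanB3 m :
    padovan (m - 3) = (window_act (window (1, 0, 0) m) (0, 1, 0)).1.1.
  by rewrite /padovan addrC windowD.
have padovanB4 m :
    padovan (m - 4) = (window_act (window (1, 0, 0) m) (0, 0, 1)).1.1.
  by rewrite /padovan addrC windowD.
(* [2 * n] becomes [n + n], so that [windowD] applies twice. *)
rewrite !perrinE !padovanB3 !padovanB4 /padovan mulr_natl mulr2n addrA.
rewrite !windowS !windowD !windowN.
case: (window _ n) => [[a b] c]; case: (window _ p) => [[x y] z] /=.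
by split; ring.
Qed.
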